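(* Let $\mathcal{R}$ be a commutative ring with unit, let $\mathcal{C}$ be a finite abstract simplicial complex, let $\mathcal{V}=\{V_0,\ldots,V_n\}$ be a partition of $V(\mathcal{C})$, and let $m\ge0$ be an integer. If $\widetilde H_{|I|+m-2}(\mathcal{C}[V_I];\mathcal{R})=0$ for all nonempty $I\subseteq\{0,1,\ldots,n\}$, where $V_I=\bigcup_{i\in I}V_i$, then $\widetilde H_{m-1}(\mathbf{Col}(\mathcal{C},\mathcal{V});\mathcal{R})=0$.
   Context: $\mathcal{C}[X]=\{\sigma\in\mathcal{C}:\sigma\subseteq X\}$. $\widetilde H_j$ denotes reduced simplicial homology (with $\widetilde H_{-1}(\mathcal{K})=0$ iff $\mathcal{K}$ has at least one vertex). The colorful complex $\mathbf{Col}(\mathcal{C},\mathcal{V})$ is the simplicial complex whose vertices are the simplices $\sigma\in\mathcal{C}$ containing at least one vertex of every class $V_i$, and whose simplices are the sets $\{\sigma_1,\ldots,\sigma_\ell\}$ of such simplices with $\sigma_1\subset\cdots\subset\sigma_\ell$. *)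

(* Defs.v *)
From mathcomp Require Import all_boot all_order all_algebra.
Set Implicit Arguments. Unset Strict Implicit. Unset Printing Implicit Defensive.
Import GRing.Theory.
Local Open Scope ring_scope.

Section Simplicial.
Variable T : finType.

Definition is_complex (K : {set {set T}}) : Prop :=
  forall s t : {set T}, s \in K -> t \subset s -> t \in K.

Definition vertices (K : {set {set T}}) : {set T} := [set v | [set v] \in K].

Definition induced (K : {set {set T}}) (X : {set T}) : {set {set T}} :=
  [set s in K | s \subset X].

(* faces with exactly k vertices (i.e. of dimension k-1); the empty face is
   always present, giving the augmented chain complex for reduced homology. *)
Definition faces (K : {set {set T}}) (k : nat) : {set {set T}} :=
  [set s | ((s \in K) || (s == set0)) && (#|s| == k)].

Definition bsign (R : comPzRingType) (s : {set T}) (v : T) : R :=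
  (-1) ^+ #|[set u in s | enum_rank u < enum_rank v]%N|.

Definition bnd (R : comPzRingType) (c : {set T} -> R) (t : {set T}) : R :=
  \sum_(s : {set T}) \sum_(v in s | s :\ v == t) bsign R s v * c s.

Definition supported_on (R : comPzRingType) (c : {set T} -> R)
  (F : {set {set T}}) : Prop := forall s, s \notin F -> c s = 0.

(* reduced_homology_vanishes R K k  <->  H~_{k-1}(K; R) = 0
   (every reduced (k-1)-cycle is a boundary). *)
Definition reduced_homology_vanishes (R : comPzRingType)
  (K : {set {set T}}) (k : nat) : Prop :=
  forall c : {set T} -> R, supported_on c (faces K k) ->
    (forall t, bnd c t = 0) ->
    exists b : {set T} -> R, supported_on b (faces K k.+1) /\
      (forall t, bnd b t = c t).

End Simplicial.

Definition colorful (T : finType) (n : nat) (C : {set {set T}})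
  (V : 'I_n.+1 -> {set T}) : {set {set T}} :=
  [set s in C | [forall i, s :&: V i != set0]].

Definition Col (T : finType) (n : nat) (C : {set {set T}})
  (V : 'I_n.+1 -> {set T}) : {set {set {set T}}} :=
  [set S : {set {set T}} | (S \subset colorful C V) &&
     [forall s in S, forall t in S, (s \subset t) || (t \subset s)]].

(* Main.v *)
(** For a color [i] let [X_i] be the order complex of the simplices of [C] that meet
    [V_i].  The simplices meeting some color form an up-closed set, so order complexes
    commute with unions and intersections of such sets: [Col C V] is the intersection of
    all the [X_i], while the union of the [X_i], [i \in J], is the order complex of the
    simplices meeting [V_J], which retracts onto the barycentric subdivision of [C[V_J]]
    by [s |-> s :&: V_J].  Acyclic carriers turn this into the vanishing of
    H~_{|J|+m-2} of the union of the [X_i], [i \in J].  Mayer-Vietoris, by induction on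
    [|I|], then gives H~_{|J|+m-1} = 0 for the complex
    [(\bigcap_(i in I) X_i) :|: (\bigcup_(j in J) X_j)] when [I] is nonempty and disjoint
    from [J]; the theorem is the case where [I] is everything and [J] is empty. *)
Require Import Defs.
From mathcomp Require Import all_boot all_order all_algebra.

Set Implicit Arguments. Unset Strict Implicit. Unset Printing Implicit Defensive.
Import GRing.Theory.
Local Open Scope ring_scope.

(** * Incidence numbers, the boundary operator and cones *)

Section Incidence.
Variables (R : comPzRingType) (T : finType).
Implicit Types (s t : {set T}) (u v : T) (c : {set T} -> R).

Definition incidence s t : R := \sum_(v in s | s :\ v == t) bsign R s v.

Lemma bndE c t : bnd c t = \sum_s incidence s t * c s.
Proof. by apply: eq_bigr => s _; rewrite mulr_suml. Qed.

Lemma bsign_sqr s v : bsign R s v * bsign R s v = 1.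
Proof. by rewrite /bsign -expr2 sqrr_sign. Qed.

Lemma bsignD1 s u v : u \in s ->
  bsign R s v = (-1) ^+ (enum_rank u < enum_rank v)%N * bsign R (s :\ u) v.
Proof.
move=> us; rewrite /bsign -exprD; congr (_ ^+ _).
rewrite (cardsD1 u) inE us /=; congr (_ + _)%N.
by apply: eq_card => w; rewrite !inE; case: (w == u); case: (w \in s).
Qed.

(** Removing the earlier of two vertices shifts the position of the later one by one, while removing
    the later leaves the earlier in place. So the two orders of removal differ by exactly one
    sign. *)
Lemma bsign_anticomm s u v : u \in s -> v \in s -> u != v ->
  bsign R s v * bsign R (s :\ v) u = - (bsign R s u * bsign R (s :\ u) v).
Proof.
move=> us vs uv; rewrite (bsignD1 v us) (bsignD1 u vs).
have : enum_rank u != enum_rank v by rewrite (inj_eq enum_rank_inj).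
rewrite -val_eqE /=; case: ltngtP => //= _ _.
  by rewrite expr1 expr0 mul1r !mulN1r mulNr mulrC.
by rewrite expr1 expr0 mul1r !mulN1r mulNr opprK mulrC.
Qed.

(** A face of codimension two is reached by removing two vertices in either order, and the two
    contributions cancel. *)
Lemma incidence_comp s t : \sum_r incidence s r * incidence r t = 0.
Proof.
pose G v u := if [&& u \in s, v \in s, u != v & (s :\ v) :\ u == t]
              then bsign R s v * bsign R (s :\ v) u else 0.
have -> : \sum_r incidence s r * incidence r t = \sum_v \sum_u G v u.
  under eq_bigr => r _ do rewrite mulr_suml.
  rewrite (exchange_big_dep (fun v => v \in s)) /=; last by move=> r v _ /andP[].
  rewrite [RHS](bigID (fun v => v \in s)) /= [X in _ + X]big1 ?addr0; last first.
    by move=> v /negbTE vs; apply: big1 => u _; rewrite /G vs /= andbF.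
  apply: eq_bigr => v vs; rewrite (big_pred1 (s :\ v)); last first.
    by move=> r; rewrite vs /= eq_sym.
  rewrite mulr_sumr big_mkcond /=; apply: eq_bigr => u _.
  rewrite /G vs !inE andbCA /=.
  by case: (u \in s); case: (u != v); rewrite ?andbF.
have anti v u : G v u = - G u v.
  rewrite /G [v == u]eq_sym (_ : (s :\ u) :\ v = (s :\ v) :\ u); last first.
    by rewrite !setDDl setUC.
  have [us|] := boolP (u \in s); last by rewrite andbF oppr0.
  have [vs|] := boolP (v \in s); last by rewrite /= oppr0.
  rewrite /=; have [uv|] := boolP (u != v); last by rewrite oppr0.
  by case: ifP => _; rewrite ?oppr0 // bsign_anticomm.
have diag v : G v v = 0 by rewrite /G eqxx !andbF.
(* Antisymmetry alone would only show that twice the sum is zero, and 2 may be a zero divisor in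
   [R]. Splitting by rank pairs each term with its opposite explicitly. *)
rewrite (eq_bigr (fun v => (\sum_(u | (enum_rank u < enum_rank v)%N) G v u) +
   \sum_(u | (enum_rank v < enum_rank u)%N) G v u)); last first.
  move=> v _; rewrite (bigID (fun u => enum_rank u < enum_rank v)%N) /=.
  congr (_ + _); rewrite (bigD1 v) ?ltnn //= diag add0r.
  apply: eq_bigl => u; rewrite -leqNgt ltn_neqAle andbC eq_sym; congr (_ && _).
  by rewrite -(inj_eq enum_rank_inj).
rewrite big_split /= [X in _ + X](exchange_big_dep predT) //=.
rewrite -big_split big1 // => v _ /=.
rewrite -big_split big1 // => u _ /=.
by rewrite anti addNr.
Qed.

Lemma bnd_setU1 c t :
  bnd c t = \sum_(u | u \notin t) bsign R (u |: t) u * c (u |: t).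
Proof.
rewrite /bnd (exchange_big_dep predT) //= [RHS]big_mkcond; apply: eq_bigr => u _.
case: ifPn => ut.
  rewrite (big_pred1 (u |: t)) // => s; apply/andP/eqP => [[us /eqP <-]|->].
    by rewrite setD1K.
  by rewrite setU11 setU1K.
rewrite big1 // => s /andP[us /eqP st]; move: ut.
by rewrite -st !inE eqxx.
Qed.

Lemma faces_mono (K L : {set {set T}}) k : K \subset L -> faces K k \subset faces L k.
Proof.
move=> /subsetP KL; apply/subsetP => s; rewrite !inE => /andP[/orP[/KL|] -> ->] //.
by rewrite orbT.
Qed.

Lemma supported_onS c (F G : {set {set T}}) :
  F \subset G -> supported_on c F -> supported_on c G.
Proof. by move=> /subsetP FG cF s sG; apply: cF; apply: contraNN sG => /FG. Qed.

Lemma supported_on_sum (I : finType) (a : I -> R) (g : I -> {set T} -> R)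
    (F : {set {set T}}) :
  (forall i, a i = 0 \/ supported_on (g i) F) ->
  supported_on (fun t => \sum_i a i * g i t) F.
Proof.
move=> H t tF; apply: big1 => i _; case: (H i) => [->|/(_ t tF) ->].
  by rewrite mul0r.
by rewrite mulr0.
Qed.

Lemma supported_onD c (d : {set T} -> R) (F : {set {set T}}) :
  supported_on c F -> supported_on d F -> supported_on (fun t => c t + d t) F.
Proof. by move=> cF dF t tF; rewrite cF ?dF ?addr0. Qed.

Lemma supported_onN c (F : {set {set T}}) :
  supported_on c F -> supported_on (fun t => - c t) F.
Proof. by move=> cF t tF; rewrite cF ?oppr0. Qed.

Lemma supported_onZ a c (F : {set {set T}}) :
  supported_on c F -> supported_on (fun t => a * c t) F.
Proof. by move=> cF t tF; rewrite cF ?mulr0. Qed.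

Lemma eq_bnd c (d : {set T} -> R) : c =1 d -> bnd c =1 bnd d.
Proof. by move=> cd t; rewrite !bndE; apply: eq_bigr => s _; rewrite cd. Qed.

Lemma bndD c (d : {set T} -> R) t :
  bnd (fun s => c s + d s) t = bnd c t + bnd d t.
Proof. by rewrite !bndE -big_split; apply: eq_bigr => s _; rewrite mulrDr. Qed.

Lemma bndN c t : bnd (fun s => - c s) t = - bnd c t.
Proof. by rewrite !bndE -sumrN; apply: eq_bigr => s _; rewrite mulrN. Qed.

Lemma bndZ a c t : bnd (fun s => a * c s) t = a * bnd c t.
Proof. by rewrite !bndE mulr_sumr; apply: eq_bigr => s _; rewrite mulrCA. Qed.

Lemma bnd_sum (I : finType) (a : I -> R) (g : I -> {set T} -> R) t :
  bnd (fun s => \sum_i a i * g i s) t = \sum_i a i * bnd (g i) t.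
Proof.
rewrite bndE; under eq_bigr => s _ do rewrite mulr_sumr.
rewrite exchange_big; apply: eq_bigr => i _ /=.
by rewrite bndE mulr_sumr; apply: eq_bigr => s _; rewrite mulrCA.
Qed.

Lemma bnd_bnd c t : bnd (bnd c) t = 0.
Proof.
rewrite bndE; under eq_bigr => s _ do rewrite bndE mulr_sumr.
rewrite exchange_big big1 //= => s _.
under eq_bigr => r _ do rewrite mulrA (mulrC (incidence r t)).
by rewrite -mulr_suml incidence_comp mul0r.
Qed.

Lemma incidence_eq0 s t : incidence s t = 0 \/ exists2 v, v \in s & t = s :\ v.
Proof.
have [/existsP[v /andP[vs /eqP <-]]|] := boolP [exists v in s, s :\ v == t].
  by right; exists v.
rewrite negb_exists => /forallP H; left; apply: big1 => v /andP[vs st].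
by move: (H v); rewrite vs st.
Qed.

Lemma bnd_supported (K : {set {set T}}) c k : is_complex K ->
  supported_on c (faces K k.+1) -> supported_on (bnd c) (faces K k).
Proof.
move=> cK cF t tF; rewrite bndE; apply: big1 => s _.
have [->|[v vs e]] := incidence_eq0 s t; first by rewrite mul0r.
rewrite cF ?mulr0 //; apply: contraNN tF; rewrite e !inE => /andP[/orP[sK|/eqP s0]].
  by rewrite (cK s _ sK) ?subD1set //= (cardsD1 v s) vs eqSS.
by rewrite s0 cards0.
Qed.

(** Joining with the apex [v] is a contracting homotopy of the augmented chain complex. *)
Lemma cone_vanishes (K : {set {set T}}) v k :
  set0 \in K -> (forall s, s \in K -> v |: s \in K) ->
  reduced_homology_vanishes R K k.
Proof.
move=> K0 Kv c cF cyc.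
(* This is the join of [v] with [c]; the sign makes the removal of [v] give back [c] with
   coefficient 1. *)
exists (fun s => if v \in s then bsign R s v * c (s :\ v) else 0); split.
  move=> s sF; case: ifP => // vs; rewrite cF ?mulr0 //.
  apply: contraNN sF; rewrite !inE => /andP[H /eqP <-].
  rewrite (cardsD1 v s) vs eqxx andbT; apply/orP; left; rewrite -(setD1K vs).
  by case/orP: H => [/Kv|/eqP ->] //; apply: Kv.
move=> t; rewrite bnd_setU1.
have [vt|vt] := boolP (v \in t); last first.
  rewrite (bigD1 v) //= setU11 setU1K // mulrA bsign_sqr mul1r big1 ?addr0 //.
  move=> u /andP[ut uv]; rewrite !inE eq_sym (negbTE uv) (negbTE vt) mulr0 //.
(* When [t] contains [v], the cycle condition at [t :\ v] expresses [c t] through the other cofaces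
   of [t :\ v]. These are the values of [c] that occur in the boundary of the join at [t], and
   [bsign_anticomm] matches the signs. *)
have := cyc (t :\ v); rewrite bnd_setU1 (bigD1 v) ?inE ?eqxx //= setD1K // => E.
have {}E : c t = - bsign R t v * \sum_(u | u \notin t)
     bsign R (u |: (t :\ v)) u * c (u |: (t :\ v)).
  move/eqP: E; rewrite addr_eq0 => /eqP E.
  rewrite -[LHS]mul1r -(bsign_sqr t v) -mulrA E mulrN mulNr; congr (- (_ * _)).
  apply: eq_bigl => u; rewrite !inE negb_and negbK.
  by case: eqVneq => [->|]; rewrite ?vt ?andbT //= ?andbF.
rewrite E mulr_sumr; apply: eq_bigr => u ut.
have uv : u != v by apply: contraNneq ut => ->.
have vs : v \in u |: t by rewrite !inE vt orbT.
have -> : u |: (t :\ v) = (u |: t) :\ v.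
  by apply/setP => w; rewrite !inE; case: eqVneq => [->|]; rewrite ?uv.
rewrite vs !mulrA; congr (_ * _).
have := bsign_anticomm (setU11 u t) vs uv; rewrite setU1K // => A.
rewrite -[bsign R (u |: t) u]mulr1 -(bsign_sqr t v) mulrA.
rewrite -[bsign R (u |: t) u * _]opprK -A !mulNr; congr (- _).
by rewrite mulrC !mulrA bsign_sqr mul1r mulrC.
Qed.

End Incidence.

(** * Acyclic carriers *)

(* The equation for [x] is that of a chain map when [d = 0], [y = 0], [eps = 1], and
   that of a null-homotopy of the chain map [y] when [d = 1], [eps = -1]. *)
Lemma carrier_solution (R : comPzRingType) (T T' : finType) (K : {set {set T}})
    (Phi : {set T} -> {set {set T'}}) (d : nat) (eps : R)
    (y : {set T} -> {set T'} -> R) (x0 : {set T'} -> R) :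
  is_complex K ->
  (forall s t : {set T}, s \in K -> t \subset s -> Phi t \subset Phi s) ->
  (forall s k, s \in K -> s != set0 -> reduced_homology_vanishes R (Phi s) k) ->
  (forall s k, s \in K -> (#|s| + d)%N = k.+1 -> supported_on (y s) (faces (Phi s) k)) ->
  (forall s t, s \in K -> bnd (y s) t = - eps * \sum_r incidence R s r * y r t) ->
  supported_on x0 (faces (Phi set0) d) -> bnd x0 =1 y set0 ->
  exists x : {set T} -> {set T'} -> R, x set0 =1 x0 /\
    forall s, s \in K -> supported_on (x s) (faces (Phi s) (#|s| + d)) /\
      forall t, bnd (x s) t = y s t + eps * \sum_r incidence R s r * x r t.
Proof.
move=> cK mono acyc ysupp ybnd x0supp x0bnd.
(* Bounding the size of [s] allows [x] to be built one skeleton at a time. *)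
suff [x [xx0 xP]] : exists x : {set T} -> {set T'} -> R, x set0 =1 x0 /\
    forall s, s \in K -> (#|s| <= #|T|)%N ->
      supported_on (x s) (faces (Phi s) (#|s| + d)) /\
      forall t, bnd (x s) t = y s t + eps * \sum_r incidence R s r * x r t.
  by exists x; split=> // s sK; apply: xP (max_card _).
elim: #|T| => [|N [x [xx0 IH]]].
  exists (fun _ => x0); split=> // s sK; rewrite leqn0 cards_eq0 => /eqP ->.
  rewrite cards0; split=> // t; rewrite x0bnd big1 ?mulr0 ?addr0 // => r _.
  by rewrite /incidence big1 ?mul0r // => v; rewrite inE.
(* In size [N.+1] the prescribed boundary is a cycle carried by [Phi s], which acyclicity fills. All
   other simplices keep their old value. *)
have step s : exists xs : {set T'} -> R,
   if (s \in K) && (#|s| == N.+1) then supported_on xs (faces (Phi s) (#|s| + d)) /\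
      forall t, bnd xs t = y s t + eps * \sum_r incidence R s r * x r t
   else xs =1 x s.
  have [/andP[sK /eqP sN]|_] := boolP (_ && _); last by exists (x s).
  rewrite sN addSn.
  apply: (acyc s) => //; first by rewrite -cards_eq0 sN.
    apply: supported_onD; first by apply: ysupp; rewrite ?sN.
    apply: supported_onZ; apply: supported_on_sum => r.
    have [->|[v vs e]] := incidence_eq0 R s r; [by left|right].
    have rs : r \subset s by rewrite e subD1set.
    have rN : #|r| = N by apply/eqP; rewrite -eqSS -sN (cardsD1 v s) vs -e.
    have [|+ _] := IH r (cK _ _ sK rs); first by rewrite rN.
    by rewrite rN; apply: supported_onS; apply: faces_mono; apply: mono.
  (* The cycle condition: the boundary of [y s] cancels the [y] terms coming from the boundaries of
     the [x r], and the remaining [x] terms contain two successive boundaries. *)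
  move=> t; rewrite bndD bndZ bnd_sum ybnd // mulNr.
  rewrite (_ : \sum_r incidence R s r * bnd (x r) t =
               \sum_r incidence R s r * y r t); first by rewrite addNr.
  transitivity (\sum_r incidence R s r *
      (y r t + eps * \sum_q incidence R r q * x q t)).
    apply: eq_bigr => r _; have [->|[v vs e]] := incidence_eq0 R s r.
      by rewrite !mul0r.
    have rs : r \subset s by rewrite e subD1set.
    have rN : #|r| = N by apply/eqP; rewrite -eqSS -sN (cardsD1 v s) vs -e.
    by have [|_ ->] := IH r (cK _ _ sK rs); first by rewrite rN.
  under eq_bigr => r _ do rewrite mulrDr mulrCA mulr_sumr.
  rewrite big_split /= -mulr_sumr exchange_big [X in eps * X]big1 ?mulr0 ?addr0 //= => q _.
  under eq_bigr => r _ do rewrite mulrA.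
  by rewrite -mulr_suml incidence_comp mul0r.
have [x' x'P] := fin_all_exists step.
have x'E (s : {set T}) : (#|s| <= N)%N -> x' s =1 x s.
  by move=> sN; have := x'P s; rewrite (ltn_eqF (_ : #|s| < N.+1)%N) ?andbF.
have incE (s : {set T}) t : (#|s| <= N.+1)%N -> \sum_r incidence R s r * x' r t =
    \sum_r incidence R s r * x r t.
  move=> sN; apply: eq_bigr => r _; have [->|[v vs e]] := incidence_eq0 R s r.
    by rewrite !mul0r.
  by rewrite x'E // -ltnS; move: sN; rewrite (cardsD1 v s) vs -e.
exists x'; split=> [t|s sK]; first by rewrite x'E ?cards0.
rewrite leq_eqVlt ltnS => /predU1P[sN|sN].
  by have := x'P s; rewrite sK sN eqxx /= => -[? H]; split=> // t; rewrite H incE ?sN.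
have [sup bx] := IH s sK sN; split=> [t /sup|t]; first by rewrite x'E.
by rewrite (eq_bnd (x'E s sN)) bx incE // leqW.
Qed.

(** * Images of chains under maps given on simplices *)

Section Pushforward.
Variables (R : comPzRingType) (T T' : finType).
Implicit Types (K : {set {set T}}) (c : {set T} -> R) (x : {set T} -> {set T'} -> R).

Lemma sum_bnd c x t :
  \sum_r bnd c r * x r t = \sum_s c s * \sum_r incidence R s r * x r t.
Proof.
under eq_bigr => r _ do rewrite bndE mulr_suml.
rewrite exchange_big; apply: eq_bigr => s _ /=.
by rewrite mulr_sumr; apply: eq_bigr => r _; rewrite mulrAC mulrC.
Qed.

(** [faces K 0] contains the empty face whatever [K] is; [set0 \in K] ensures that the equation for
    [x] is available there too. *)
Lemma bnd_pushforward K c x k t : set0 \in K -> supported_on c (faces K k) ->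
  (forall s, s \in K -> forall t, bnd (x s) t = \sum_r incidence R s r * x r t) ->
  bnd (fun t => \sum_s c s * x s t) t = \sum_r bnd c r * x r t.
Proof.
move=> K0 cF bx; rewrite bnd_sum sum_bnd; apply: eq_bigr => s _.
have [sK|sK] := boolP (s \in K); first by rewrite bx.
rewrite cF ?mul0r //; apply: contraNN sK; rewrite inE.
by case/andP=> /orP[//|/eqP->] _.
Qed.

Definition basis_chain (s : {set T}) : {set T} -> R := fun t => (s == t)%:R.

Lemma sum_basis_chain s (f : {set T} -> R) : \sum_r f r * basis_chain r s = f s.
Proof.
rewrite (bigD1 s) //= /basis_chain eqxx mulr1 big1 ?addr0 // => r /negbTE ->.
by rewrite mulr0.
Qed.

Lemma bnd_basis_chain s t : bnd (basis_chain s) t = incidence R s t.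
Proof.
rewrite bndE (bigD1 s) //= /basis_chain eqxx mulr1 big1 ?addr0 // => r.
by rewrite eq_sym => /negbTE ->; rewrite mulr0.
Qed.

Lemma incidence_set0 t : incidence R (@set0 T) t = 0.
Proof. by rewrite /incidence big1 // => v; rewrite inE. Qed.

End Pushforward.

Lemma basis_chain_supported (R : comPzRingType) (T : finType) (K : {set {set T}})
    (s : {set T}) :
  (s \in K) || (s == set0) -> supported_on (basis_chain R s) (faces K #|s|).
Proof.
move=> sK t; rewrite inE /basis_chain; case: (eqVneq s t) => // <-.
by rewrite sK eqxx.
Qed.

(** Sending the empty simplex to the empty simplex makes the chain map preserve augmentations, as
    reduced homology requires. *)
Lemma carrier_map (R : comPzRingType) (T T' : finType) (K : {set {set T}})
    (Phi : {set T} -> {set {set T'}}) :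
  is_complex K ->
  (forall s t : {set T}, s \in K -> t \subset s -> Phi t \subset Phi s) ->
  (forall s k, s \in K -> s != set0 -> reduced_homology_vanishes R (Phi s) k) ->
  exists x : {set T} -> {set T'} -> R, x set0 =1 basis_chain R set0 /\
    forall s, s \in K -> supported_on (x s) (faces (Phi s) #|s|) /\
      forall t, bnd (x s) t = \sum_r incidence R s r * x r t.
Proof.
move=> cK mono acyc.
have [| | | |x [x0 xP]] := @carrier_solution R T T' K Phi 0 1 (fun _ _ => 0)
  (basis_chain R set0) cK mono acyc.
- by [].
- by move=> s t _; rewrite bndE !big1 ?mulr0 // => r _; rewrite mulr0.
- by rewrite -(@cards0 T'); apply: basis_chain_supported; rewrite eqxx orbT.
- by move=> t; rewrite bnd_basis_chain incidence_set0.
exists x; split=> // s /xP; rewrite addn0 => -[? bx]; split=> // t.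
by rewrite bx add0r mul1r.
Qed.

(** * A fragment of the Mayer-Vietoris sequence *)

(** A cycle of the intersection bounds [a] in [A] and [b] in [B]. The cycle [a - b] bounds some [e]
    in the union, and [e] serves to correct [a] until it lies in both complexes. *)
Lemma union_inter_vanishes (R : comPzRingType) (T : finType) (A B : {set {set T}}) k :
  is_complex A -> is_complex B ->
  reduced_homology_vanishes R (A :|: B) k.+1 ->
  reduced_homology_vanishes R A k -> reduced_homology_vanishes R B k ->
  reduced_homology_vanishes R (A :&: B) k.
Proof.
move=> cA cB HAB HA HB c cF cyc.
have [a [aF ba]] := HA c (supported_onS (faces_mono _ (subsetIl A B)) cF) cyc.
have [b [bF bb]] := HB c (supported_onS (faces_mono _ (subsetIr A B)) cF) cyc.
have [|t|e [eF be]] := HAB (fun t => a t - b t).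
- apply: supported_onD.
    by apply: supported_onS aF; apply: faces_mono; apply: subsetUl.
  by apply: supported_onN; apply: supported_onS bF; apply: faces_mono; apply: subsetUr.
- by rewrite bndD bndN ba bb subrr.
(* Simplices common to [A] and [B] are assigned to [eA], so [e] is the sum of [eA] and [eB] without
   overlap. *)
pose eA s := if s \in A then e s else 0.
pose eB s := if s \in A then 0 else e s.
have eAF : supported_on eA (faces A k.+2).
  move=> s; rewrite /eA; case: ifP => // sA sF; apply: eF.
  by move: sF; rewrite !inE sA.
have eBF : supported_on eB (faces B k.+2).
  move=> s; rewrite /eB; case: ifP => // sA sF; apply: eF.
  by move: sF; rewrite !inE sA.
have eE t : a t - bnd eA t = b t + bnd eB t.
  apply/eqP; rewrite subr_eq -addrA -bndD addrC -subr_eq -be; apply/eqP.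
  by apply: eq_bnd => s; rewrite /eA /eB; case: ifP; rewrite ?addr0 ?add0r.
exists (fun t => a t - bnd eA t); split; last first.
  by move=> t; rewrite bndD bndN bnd_bnd subr0 ba.
have sA : supported_on (fun t => a t - bnd eA t) (faces A k.+1).
  by apply: supported_onD => //; apply: supported_onN; apply: bnd_supported.
have sB : supported_on (fun t => a t - bnd eA t) (faces B k.+1).
  move=> t tF; rewrite eE; move: t tF.
  by apply: supported_onD => //; apply: bnd_supported.
move=> t tF; have [tA|/sA //] := boolP (t \in faces A k.+1).
apply: sB; apply: contraNN tF; move: tA.
rewrite !inE => /andP[tA tk] /andP[tB _]; rewrite tk andbT.
(* A face with [k.+1] vertices is nonempty, so being a face here means belonging to the complex
   itself. *)
have /negbTE t0 : t != set0 by rewrite -cards_eq0 (eqP tk).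
by move: tA tB; rewrite t0 !orbF => -> ->.
Qed.

(** * Order complexes of families of simplices *)

(** [Col C V] is convertible to [chains (colorful C V)]; allowing any family [Q] gives the
    intermediate complexes of the induction. *)
Definition chains (T : finType) (Q : {set {set T}}) : {set {set {set T}}} :=
  [set S : {set {set T}} | (S \subset Q) &&
     [forall s in S, forall t in S, (s \subset t) || (t \subset s)]].

Section Chains.
Variables (R : comPzRingType) (T : finType).
Implicit Types (Q P : {set {set T}}) (S : {set {set T}}).

Lemma chainsP Q S :
  reflect (S \subset Q /\ {in S &, forall s t : {set T}, (s \subset t) || (t \subset s)})
          (S \in chains Q).
Proof.
rewrite inE; apply: (iffP andP) => -[SQ H]; split=> //.
  by move=> s t sS tS; move/forall_inP/(_ s sS)/forall_inP: H; apply.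
by apply/forall_inP => s sS; apply/forall_inP => t tS; apply: H.
Qed.

Lemma set0_chains Q : set0 \in chains Q.
Proof. by apply/chainsP; split=> [|s t]; rewrite ?sub0set ?inE. Qed.

Lemma chains_complex Q : is_complex (chains Q).
Proof.
move=> S U /chainsP[SQ H] US; apply/chainsP; split; first exact: subset_trans US SQ.
by move=> s t /(subsetP US) sS /(subsetP US) tS; apply: H.
Qed.

Lemma chainsS Q P : Q \subset P -> chains Q \subset chains P.
Proof.
move=> QP; apply/subsetP => S /chainsP[SQ H]; apply/chainsP; split=> //.
exact: subset_trans QP.
Qed.

Lemma chainsI Q P : chains (Q :&: P) = chains Q :&: chains P.
Proof.
apply/setP => S; rewrite !inE subsetI.
by case: (S \subset Q); case: (S \subset P); rewrite //= ?andbb ?andbF.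
Qed.

(** A chain contained in neither family would have a member outside [Q] and one outside [P]. These
    are comparable, so upward closure puts the larger of them in the family it avoids. *)
Lemma chainsU Q P :
  (forall s t : {set T}, s \in Q -> t \in Q :|: P -> s \subset t -> t \in Q) ->
  (forall s t : {set T}, s \in P -> t \in Q :|: P -> s \subset t -> t \in P) ->
  chains (Q :|: P) = chains Q :|: chains P.
Proof.
move=> upQ upP; apply/setP => S; rewrite [RHS]inE.
apply/idP/orP; last first.
  by case; apply/subsetP/chainsS; rewrite ?subsetUl ?subsetUr.
move=> /chainsP[SQP H].
have [SQ|/subsetPn[s sS sQ]] := boolP (S \subset Q); first by left; apply/chainsP.
have [SP|/subsetPn[t tS tP]] := boolP (S \subset P); first by right; apply/chainsP.
have sQP := subsetP SQP s sS; have tQP := subsetP SQP t tS.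
have sP : s \in P by move: sQP; rewrite inE (negbTE sQ).
have tQ : t \in Q by move: tQP; rewrite inE (negbTE tP) orbF.
by case/orP: (H s t sS tS) => [/(upP s t sP tQP)|/(upQ t s tQ sQP)];
  rewrite ?(negbTE tP) ?(negbTE sQ).
Qed.

(** The union of a nonempty chain is its largest member. Using [cover] for the top also gives a
    value, [set0], on the empty chain. *)
Lemma cover_chain_mem Q S : S \in chains Q -> S != set0 -> cover S \in S.
Proof.
move=> /chainsP[_ H] /set0Pn[s0 s0S].
case: (arg_maxnP (fun s : {set T} => #|s|) s0S) => s sS smax.
suff -> : cover S = s by [].
apply/eqP; rewrite eqEsubset (bigcup_sup s) // andbT; apply/bigcupsP => t tS.
case/orP: (H t s tS sS) => // st.
by have /eqP -> : s == t by rewrite eqEcard st; apply: smax.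
Qed.

Lemma cover_chain_in Q S : S \in chains Q -> S != set0 -> cover S \in Q.
Proof.
move=> SQ S0; have /chainsP[/subsetP H _] := SQ.
by apply: H; apply: cover_chain_mem SQ S0.
Qed.

Lemma chains_top_vanishes Q q k : q \in Q -> (forall s : {set T}, s \in Q -> s \subset q) ->
  reduced_homology_vanishes R (chains Q) k.
Proof.
move=> qQ top; apply: (@cone_vanishes _ _ _ q); first exact: set0_chains.
move=> S /chainsP[/subsetP SQ H]; apply/chainsP; split.
  by apply/subsetP => s; rewrite !inE => /predU1P[->|/SQ].
move=> s t; rewrite !inE => /predU1P[->|sS] /predU1P[->|tS].
- by rewrite subxx.
- by rewrite (top t) ?orbT ?SQ.
- by rewrite (top s) ?SQ.
- exact: H.
Qed.

End Chains.

Lemma cover_chain_complex (T : finType) (C Q : {set {set T}}) (S : {set {set T}}) :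
  set0 \in C -> Q \subset C -> S \in chains Q -> cover S \in C.
Proof.
move=> C0 QC SQ; have [->|S0] := eqVneq S set0; first by rewrite /cover big_set0.
by apply: (subsetP QC); apply: cover_chain_in SQ S0.
Qed.

Lemma coverS (T : finType) (S U : {set {set T}}) : U \subset S -> cover U \subset cover S.
Proof. by move=> /subsetP US; apply/bigcupsP => s /US sS; apply: bigcup_sup. Qed.

(** * Retraction onto the subdivided induced complex *)

(** It suffices to have chain maps to [induced C X] and back whose composite on the order complex is
    homotopic to the identity; the other composite is not considered. *)
Lemma star_vanishes (R : comPzRingType) (T : finType) (C : {set {set T}})
    (X : {set T}) k :
  is_complex C -> set0 \in C ->
  reduced_homology_vanishes R (induced C X) k ->
  reduced_homology_vanishes R (chains [set s in C | s :&: X != set0]) k.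
Proof.
move=> cC C0 HX; set P := [set s in C | _].
have PC : P \subset C by apply/subsetP => s; rewrite inE => /andP[].
have cI : is_complex (induced C X).
  move=> s t; rewrite !inE => /andP[sC sX] ts.
  by rewrite (cC s) //= (subset_trans ts).
have I0 : set0 \in induced C X by rewrite inE C0 sub0set.
have cP := @chains_complex _ P; have P0 := set0_chains P.
pose Phi1 (S : {set {set T}}) := powerset (X :&: cover S).
pose Phi2 (s : {set T}) := chains (powerset s :\ set0).
pose Phi3 (S : {set {set T}}) := chains (P :&: powerset (cover S)).
(* The top of a nonempty chain in [P] meets [X], so [Phi1] gives a full simplex with at least one
   vertex, hence a cone. *)
have [S t SP US|S j SP S0|g [g0 gP]] := @carrier_map R _ _ (chains P) Phi1 cP.
- by rewrite powersetS setIS // coverS.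
- have := cover_chain_in SP S0; rewrite inE => /andP[_ /set0Pn[v]].
  rewrite inE => /andP[vS vX]; apply: (@cone_vanishes _ _ _ v) => [|s].
    by rewrite powersetE sub0set.
  by rewrite !powersetE subUset sub1set inE vX vS.
(* [q] plays the role of barycentric subdivision: its carrier at [s] is the order complex of the
   nonempty faces of [s], a cone with apex [s]. *)
have [s t sC ts|s j sC s0|q [q0 qP]] := @carrier_map R _ _ (induced C X) Phi2 cI.
- by apply: chainsS; rewrite setSD // powersetS.
- apply: (@chains_top_vanishes _ _ _ s) => [|t].
    by rewrite !inE s0 subxx.
  by rewrite !inE => /andP[].
(* The difference between [q] after [g] and the identity. Both are carried by [Phi3], a cone with
   apex the top of the chain, which yields a null-homotopy [h]. *)
pose e S U := \sum_s g S s * q s U + - basis_chain R S U.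
have Phi1I S : S \in chains P -> Phi1 S \subset induced C X.
  move=> SP; apply/subsetP => s; rewrite inE => sS.
  rewrite inE (subset_trans sS) ?subsetIl // andbT.
  apply: (cC (cover S)); first exact: cover_chain_complex SP.
  exact: subset_trans sS (subsetIr _ _).
have Phi23 S s : S \in chains P -> s \in Phi1 S -> Phi2 s \subset Phi3 S.
  move=> SP sS; apply: chainsS; apply/subsetP => t; rewrite !inE => /andP[t0 ts].
  move: sS; rewrite inE subsetI => /andP[sX sS]; have tS := subset_trans ts sS.
  rewrite tS andbT (cC _ _ (cover_chain_complex C0 PC SP) tS) /=.
  by rewrite (setIidPl (subset_trans ts sX)).
have [S U SP US|S j SP S0|S j SP|S U SP| |U|h [h0 hP]] :=
  @carrier_solution R _ _ (chains P) Phi3 1 (-1) e (fun _ => 0) cP.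
- by apply: chainsS; rewrite setIS // powersetS coverS.
- apply: (@chains_top_vanishes _ _ _ (cover S)) => [|t].
    by rewrite in_setI (cover_chain_in SP S0) powersetE subxx.
  by rewrite in_setI powersetE => /andP[].
- rewrite addn1 => -[<-]; have [gF _] := gP S SP.
  apply: supported_onD.
    apply: supported_on_sum => s; have [sF|sF] := boolP (s \in faces (Phi1 S) #|S|).
      right; move: sF; rewrite inE => /andP[sS /eqP <-].
      have {}sS : s \in Phi1 S by case/orP: sS => // /eqP ->; rewrite powersetE sub0set.
      have [+ _] := qP s (subsetP (Phi1I S SP) s sS).
      by apply: supported_onS; apply: faces_mono; apply: Phi23.
    by left; apply: gF.
  apply: supported_onN; apply: basis_chain_supported; apply/orP; left.
  have /chainsP[SsP H] := SP; apply/chainsP; split=> //.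
  by rewrite subsetI SsP; apply/subsetP => s sS; rewrite powersetE; apply: bigcup_sup.
- have [gF gb] := gP S SP.
  rewrite opprK mul1r bndD bndN bnd_basis_chain.
  rewrite (@bnd_pushforward _ _ _ (induced C X) _ _ #|S|) //; last 2 first.
  + by apply: supported_onS gF; apply: faces_mono; apply: Phi1I.
  + by move=> s sI; have [] := qP s sI.
  under eq_bigr => r _ do rewrite gb mulr_suml.
  rewrite exchange_big -[incidence R S U](sum_basis_chain U) -sumrN -big_split /=.
  apply: eq_bigr => r _; rewrite mulrDr mulrN mulr_sumr; congr (_ + _).
  by apply: eq_bigr => s _; rewrite mulrA.
- by [].
- rewrite bndE big1 => [|S _]; last by rewrite mulr0.
  rewrite /e; under eq_bigr => s _ do rewrite g0 mulrC /basis_chain eq_sym.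
  by rewrite sum_basis_chain q0 subrr.
move=> c cF cyc; pose gc s := \sum_S c S * g S s.
have gcb t : bnd gc t = 0.
  rewrite (@bnd_pushforward _ _ _ (chains P) _ _ k) //; last first.
    by move=> S SP; have [] := gP S SP.
  by apply: big1 => S _; rewrite cyc mul0r.
have [|//|b [bF bb]] := HX gc.
  apply: supported_on_sum => S; have [SF|SF] := boolP (S \in faces (chains P) k).
    right; move: SF; rewrite inE => /andP[SP /eqP <-].
    have {}SP : S \in chains P by case/orP: SP => // /eqP ->.
    by have [+ _] := gP S SP; apply: supported_onS; apply: faces_mono; apply: Phi1I.
  by left; apply: cF.
(* With [b] bounding [g c], the boundary of [q b] is [q (g c)]. Since [c] is a cycle, the boundary
   of [h c] is [q (g c) - c], so [q b - h c] bounds [c]. *)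
exists (fun U => \sum_s b s * q s U + - \sum_S c S * h S U); split.
  apply: supported_onD.
    apply: supported_on_sum => s; have [sF|sF] := boolP (s \in faces (induced C X) k.+1).
      right; move: sF; rewrite inE => /andP[sC /eqP <-].
      have {}sC : s \in induced C X by case/orP: sC => // /eqP ->.
      have [+ _] := qP s sC; apply: supported_onS; apply: faces_mono; apply: chainsS.
      apply/subsetP => t; rewrite !inE => /andP[t0 ts].
      move: sC; rewrite inE => /andP[sC sX].
      by rewrite (cC _ _ sC ts) (setIidPl (subset_trans ts sX)).
    by left; apply: bF.
  apply: supported_onN; apply: supported_on_sum => S.
  have [SF|SF] := boolP (S \in faces (chains P) k); last by left; apply: cF.
  right; move: SF; rewrite inE => /andP[SP /eqP <-].
  have {}SP : S \in chains P by case/orP: SP => // /eqP ->.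
  have [+ _] := hP S SP; rewrite addn1; apply: supported_onS; apply: faces_mono.
  by apply: chainsS; apply: subsetIl.
move=> U; rewrite bndD bndN (@bnd_pushforward _ _ _ (induced C X) _ _ k.+1) //; last first.
  by move=> s sC; have [] := qP s sC.
rewrite bnd_sum.
have -> : \sum_S c S * bnd (h S) U = \sum_S c S * e S U.
  transitivity (\sum_S c S * (e S U - \sum_r incidence R S r * h r U)).
    apply: eq_bigr => S _; have [SF|SF] := boolP (S \in faces (chains P) k).
      move: SF; rewrite inE => /andP[SP _].
      have {}SP : S \in chains P by case/orP: SP => // /eqP ->.
      by have [_ ->] := hP S SP; rewrite mulN1r.
    by rewrite cF ?mul0r.
  under eq_bigr => S _ do rewrite mulrBr.
  rewrite sumrB -sum_bnd [X in _ - X]big1 ?subr0 // => S _.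
  by rewrite cyc mul0r.
under [X in _ - X]eq_bigr => S _ do rewrite mulrBr mulr_sumr.
rewrite sumrB sum_basis_chain opprB addrC -addrA exchange_big /=.
rewrite [X in c U + X](_ : _ = 0) ?addr0 // addrC; apply/eqP; rewrite subr_eq0; apply/eqP.
apply: eq_bigr => s _; rewrite bb mulr_suml.
by apply: eq_bigr => S _; rewrite mulrA.
Qed.

(** * Induction on the colors *)

Theorem theorem4p1 (R : comPzRingType) (T : finType) (C : {set {set T}})
  (n : nat) (V : 'I_n.+1 -> {set T}) (m : nat) :
  is_complex C ->
  (* V is a partition of V(C) into n+1 nonempty blocks *)
  (forall i, V i != set0) ->
  (forall i j, i != j -> [disjoint V i & V j]) ->
  \bigcup_(i < n.+1) V i = vertices C ->
  (* H~_{|I|+m-2}(C[V_I]; R) = 0 for all nonempty I *)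
  (forall I : {set 'I_n.+1}, I != set0 ->
     reduced_homology_vanishes R (induced C (\bigcup_(i in I) V i))
       (#|I| + m - 1)) ->
  (* H~_{m-1}(Col(C,V); R) = 0 *)
  reduced_homology_vanishes R (Col C V) m.
Proof.
move=> cC V0 _ VC HI.
have C0 : set0 \in C.
  have /set0Pn[v vV] := V0 ord0.
  have : v \in vertices C by rewrite -VC; apply/bigcupP; exists ord0.
  by rewrite inE => vC; apply: cC vC (sub0set _).
(* Writing the union as a disjunction on simplices lets all the complexes of the induction be order
   complexes of up-closed families in [C]. *)
pose Q (I J : {set 'I_n.+1}) := [set s in C | [forall i in I, s :&: V i != set0]
  || (s :&: \bigcup_(j in J) V j != set0)].
have Qup (I J : {set 'I_n.+1}) (s t : {set T}) :
    s \in Q I J -> t \in C -> s \subset t -> t \in Q I J.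
  have meet (X : {set T}) : s \subset t -> s :&: X != set0 -> t :&: X != set0.
    by move=> st; apply: contraNneq => tX; rewrite -subset0 -tX setSI.
  rewrite !inE => /andP[_ H] -> st /=; case/orP: H => [/forall_inP H|H]; apply/orP.
    by left; apply/forall_inP => i iI; apply: meet (H i iI).
  by right; apply: meet H.
(* Meeting [V i] or [V_J] is the same as meeting the union over [i |: J]. As [i] is not in [J], the
   hypothesis on [i |: J] has index [(#|J| + 1) + m - 1], which is [#|J| + m]. *)
have single i (J : {set 'I_n.+1}) : i \notin J ->
    reduced_homology_vanishes R (chains (Q [set i] J)) (#|J| + m).
  move=> iJ.
  have -> : Q [set i] J = [set s in C | s :&: \bigcup_(j in i |: J) V j != set0].
    apply/setP => s; rewrite !inE big_setU1 //= setIUr setU_eq0 negb_and.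
    congr (_ && (_ || _)); apply/forall_inP/idP => [->|H j]; rewrite ?set11 //.
    by rewrite inE => /eqP ->.
  apply: star_vanishes => //; have := HI (i |: J).
  by rewrite cardsU1 iJ -addnA add1n subn1; apply; apply/set0Pn; exists i; rewrite setU11.
suff step N (I J : {set 'I_n.+1}) : #|I| = N.+1 -> [disjoint I & J] ->
    reduced_homology_vanishes R (chains (Q I J)) (#|J| + m).
  have := @step n setT set0; rewrite cardsT card_ord cards0 => /(_ erefl).
  rewrite disjoint_sym disjoints_subset sub0set => /(_ isT).
  rewrite (_ : Q setT set0 = colorful C V) //.
  apply/setP => s; rewrite !inE big_set0 setI0 eqxx orbF; congr (_ && _).
  by apply: eq_forallb => i; rewrite inE.
elim: N I J => [|N IH] I J cI dIJ.
  have /cards1P[i Ii] : #|I| == 1%N by rewrite cI.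
  by rewrite Ii; apply: single; move: dIJ; rewrite Ii disjoints1.
have /set0Pn[i iI] : I != set0 by rewrite -cards_eq0 cI.
have iJ : i \notin J by apply: contraTN dIJ => iJ; apply/pred0Pn; exists i; rewrite /= iI.
have cI' : #|I :\ i| = N.+1 by apply/eqP; rewrite -eqSS -cI (cardsD1 i I) iI.
have dI' : [disjoint I :\ i & J] by apply: disjointWl dIJ; apply: subD1set.
have QI : Q I J = Q (I :\ i) J :&: Q [set i] J.
  apply/setP => s; rewrite !inE; case: (s \in C) => //=.
  rewrite -orb_andl; congr (_ || _).
  apply/forall_inP/andP => [H|[/forall_inP H1 /forall_inP H2] j jI].
    split; apply/forall_inP => j; rewrite !inE; first by case/andP=> _; apply: H.
    by move/eqP->; apply: H.
  by have [->|ji] := eqVneq j i; [apply: H2; rewrite set11|apply: H1; rewrite !inE ji].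
have QU : Q (I :\ i) (i |: J) = Q (I :\ i) J :|: Q [set i] J.
  apply/setP => s; rewrite !inE; case: (s \in C) => //=.
  rewrite big_setU1 //= setIUr setU_eq0 negb_and.
  have -> : [forall j in [set i], s :&: V j != set0] = (s :&: V i != set0).
    apply/forall_inP/idP => [->|H j]; rewrite ?set11 //.
    by rewrite inE => /eqP ->.
  by case: [forall _ in _, _]; case: (s :&: V i == set0); case: (_ == set0).
(* The union is needed one degree higher, which is the shift caused by moving [i] from [I] to [J];
   the induction hypothesis for [I :\ i] covers both this term and the first factor. *)
rewrite QI chainsI; apply: union_inter_vanishes; try exact: chains_complex.
- rewrite -chainsU -?QU => [|s t sQ|s t sQ].
  + rewrite (_ : (#|J| + m).+1 = #|i |: J| + m)%N; last by rewrite cardsU1 iJ.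
    apply: IH => //; rewrite disjoint_sym disjoints_subset subUset sub1set.
    by rewrite !inE eqxx -disjoints_subset disjoint_sym.
  + by rewrite inE => /andP[tC _]; apply: Qup tC.
  + by rewrite inE => /andP[tC _]; apply: Qup tC.
- exact: IH.
- exact: single.
Qed.
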